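(* Let $K$ be the nonempty finite set of targets of a single goal $g$, and for each $\kappa\in K$ let $C_\kappa: X\times U\to\mathbb{R}$ be a user cost function. Define the probability of a trajectory $\xi$ and target $\kappa$ as $p(\xi,\kappa)\propto\exp(-C_\kappa(\xi))$. Let $V^{\approx}_{\kappa}$ and $Q^{\approx}_{\kappa}$ be the soft-value functions for target $\kappa$. Then the soft value functions $V^{\approx}_g$ and $Q^{\approx}_g$ for the goal $g$ can be computed as $$V^{\approx}_{g}(x)=\operatorname*{soft\,min}_{\kappa\in K}V^{\approx}_{\kappa}(x),\qquad Q^{\approx}_{g}(x,u)=\operatorname*{soft\,min}_{\kappa\in K}Q^{\approx}_{\kappa}(x,u).$$ That is, with the time index written out, the functions $V^{\approx}_{g,t}(x):=\operatorname{soft\,min}_{\kappa}V^{\approx}_{\kappa,t}(x)$ and $Q^{\approx}_{g,t}(x,u):=\operatorname{soft\,min}_{\kappa}Q^{\approx}_{\kappa,t}(x,u)$ satisfy, for every time $t\in\{0,\dots,T\}$, state $x\in X$ and input $u\in U$, $$\pi_t(u\mid x,g)=\exp\bigl(V^{\approx}_{g,t}(x)-Q^{\approx}_{g,t}(x,u)\bigr),$$ where $\pi_t(u\mid x,g)$ is the probability density of the input at time $t$ in state $x$ under the model $p(\xi,\kappa)\propto\exp(-C_\kappa(\xi))$, obtained by marginalizing over the target and over all future inputs.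
   Context: Setting: $X$ is the state space, $U$ the (continuous) space of user inputs with a fixed reference measure $du$, and $f: X\times U\to X$ a deterministic transition map (applying input $u$ in state $x$ leads to $x'=f(x,u)$). The horizon has final time step $T$. Trajectories: a trajectory starting at $x$ at time $t$ is $\xi=(x_t,u_t,\dots,x_T,u_T)$ with $x_t=x$ and $x_{s+1}=f(x_s,u_s)$; it is determined by $x$ and the inputs $u_t,\dots,u_T$, and integrals over trajectories starting at $x$ at time $t$ are integrals over $(u_t,\dots,u_T)\in U^{T-t+1}$. The cost of a trajectory is $C_\kappa(\xi)=\sum_s C_\kappa(x_s,u_s)$. Soft minimum: for a continuous variable, $\operatorname{soft\,min}_{y}h(y)=-\log\int\exp(-h(y))\,dy$; for the finite set of targets, $\operatorname{soft\,min}_{\kappa\in K}h(\kappa)=-\log\sum_{\kappa\in K}\exp(-h(\kappa))$. Soft value functions of a target: $V^{\approx}_{\kappa,T+1}\equiv 0$ and, for $t=T,\dots,0$, $$Q^{\approx}_{\kappa,t}(x,u)=C_\kappa(x,u)+V^{\approx}_{\kappa,t+1}(f(x,u)),\qquad V^{\approx}_{\kappa,t}(x)=\operatorname*{soft\,min}_{u\in U}Q^{\approx}_{\kappa,t}(x,u),$$ equivalently $\exp(-V^{\approx}_{\kappa,t}(x))=\int\exp(-C_\kappa(\xi))\,d\xi$ over trajectories starting at $x$ at time $t$. All functions are assumed measurable and all these integrals finite and positive. Model for the goal: given state $x$ at time $t$, the pair $(\xi,\kappa)$ of a trajectory starting at $x$ at time $t$ and a target has joint density proportional to $\exp(-C_\kappa(\xi))$,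 normalized by $\sum_{\kappa'\in K}\int\exp(-C_{\kappa'}(\xi))\,d\xi$; $\pi_t(u\mid x,g)$ is the resulting marginal density of $u_t$ at $u$. Soft value functions of the goal $g$ are functions $V^{\approx}_{g,t}$, $Q^{\approx}_{g,t}$ with $\pi_t(u\mid x,g)=\exp(V^{\approx}_{g,t}(x)-Q^{\approx}_{g,t}(x,u))$. *)

(* Defs.v *)
From HB Require Import structures.
From mathcomp Require Import all_boot all_order all_algebra.
From mathcomp Require Import all_classical all_reals all_analysis.

Set Implicit Arguments.
Unset Strict Implicit.
Unset Printing Implicit Defensive.

Import Order.TTheory GRing.Theory Num.Theory.
Import numFieldNormedType.Exports.

Local Open Scope classical_set_scope.
Local Open Scope ring_scope.

Section ConsMeasure.
Context (R : realType) (d : measure_display) (U : measurableType d).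
Variables (mu : {sigma_finite_measure set U -> \bar R}) (n : nat).
Variable nu : {sigma_finite_measure set (n.-tuple U) -> \bar R}.

Definition cons_pair (p : U * n.-tuple U) : n.+1.-tuple U :=
  [tuple of p.1 :: p.2].

Lemma measurable_cons_pair : measurable_fun [set: U * n.-tuple U] cons_pair.
Proof. exact: measurable_cons. Qed.

Definition cons_measure : set (n.+1.-tuple U) -> \bar R :=
  pushforward (mu \x nu)%E cons_pair.

Lemma measurable_preimage_cons_pair (A : set (n.+1.-tuple U)) :
  measurable A -> measurable (cons_pair @^-1` A).
Proof.
by move=> mA; rewrite -[X in measurable X]setTI; exact: measurable_cons_pair.
Qed.

Lemma cons_measure0 : cons_measure set0 = 0%E.
Proof. by rewrite /cons_measure /pushforward preimage_set0 measure0. Qed.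

Lemma cons_measure_ge0 (A : set (n.+1.-tuple U)) : (0 <= cons_measure A)%E.
Proof. exact: (measure_ge0 (product_measure1 mu nu)). Qed.

Lemma cons_measure_sigma_additive : semi_sigma_additive cons_measure.
Proof.
move=> F mF tF mUF; rewrite /cons_measure /pushforward preimage_bigcup.
apply: measure_semi_sigma_additive.
- by move=> i; exact: measurable_preimage_cons_pair.
- apply/trivIsetP => /= i j _ _ ij; rewrite -preimage_setI.
  by move/trivIsetP : tF => /(_ _ _ _ _ ij) ->//; rewrite preimage_set0.
- by rewrite -preimage_bigcup; exact: measurable_preimage_cons_pair.
Qed.

HB.instance Definition _ := isMeasure.Build _ _ _ cons_measure
  cons_measure0 cons_measure_ge0 cons_measure_sigma_additive.

Lemma cons_measureE (A : set U) (B : set (n.-tuple U)) :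
  measurable A -> measurable B ->
  cons_measure [set w | A (thead w) /\ B [tuple of behead w]] = (mu A * nu B)%E.
Proof.
move=> mA mB; rewrite -product_measure1E//; congr (product_measure1 _ _ _).
have bK (u : U) v : [tuple of behead (cons_pair (u, v))] = v by exact/val_inj.
by apply/seteqP; split=> -[u v] /=; rewrite bK.
Qed.

Lemma cons_measure_sigma_finite : sigma_finite setT cons_measure.
Proof.
have /sigma_finiteP[F [TF ndF Foo]] := sigma_finiteT mu.
have /sigma_finiteP[G [TG ndG Goo]] := sigma_finiteT nu.
exists (fun k => [set w | F k (thead w) /\ G k [tuple of behead w]]).
  apply/seteqP; split=> // w _.
  have [i _ Fi] : (\bigcup_i F i) (thead w) by rewrite -TF.
  have [j _ Gj] : (\bigcup_i G i) [tuple of behead w] by rewrite -TG.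
  exists (maxn i j) => //; split.
  - by move: Fi; apply/subsetPset/ndF/leq_maxl.
  - by move: Gj; apply/subsetPset/ndG/leq_maxr.
move=> k; have [mF Fk] := Foo k; have [mG Gk] := Goo k; split.
  apply: measurableI.
  - rewrite -[X in measurable X]setTI.
    exact: (@measurable_tnth _ U n.+1 ord0).
  - rewrite -[X in measurable X]setTI.
    exact: (@measurable_behead _ U n).
by rewrite cons_measureE// lte_mul_pinfty// ge0_fin_numE.
Qed.

HB.instance Definition _ :=
  Measure_isSigmaFinite.Build _ _ _ cons_measure cons_measure_sigma_finite.

End ConsMeasure.

(* The n-fold product measure du_1 ... du_n on U^n. *)
Fixpoint pow_measure (R : realType) (d : measure_display)
    (U : measurableType d) (mu : {sigma_finite_measure set U -> \bar R})
    (n : nat) : {sigma_finite_measure set (n.-tuple U) -> \bar R} :=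
  match n with
  | 0 => \d_([tuple] : 0.-tuple U)
  | m.+1 => cons_measure mu (pow_measure mu m)
  end.

Lemma pow_measure_box (R : realType) (d : measure_display)
    (U : measurableType d) (mu : {sigma_finite_measure set U -> \bar R})
    (n : nat) (A : 'I_n -> set U) (mA : forall i, measurable (A i)) :
  pow_measure mu n [set w | forall i, A i (tnth w i)]
  = (\prod_(i < n) mu (A i))%E.
Proof.
elim: n A mA => [|n IH] A mA.
  rewrite big_ord0 /= diracE; rewrite mem_set// => -[]//.
rewrite big_ord_recl /= -IH// -cons_measureE//; last first.
  rewrite (_ : [set w | _] = \bigcap_(i in [set: 'I_n])
      [set w : n.-tuple U | A (lift ord0 i) (tnth w i)]); last first.
    by apply/seteqP; split=> w /= H i; [move=> _; exact: H|exact: H].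
  apply: fin_bigcap_measurable => // i _.
  by rewrite -[X in measurable X]setTI; exact: measurable_tnth.
congr (cons_measure _ _ _); apply/seteqP; split=> w /=.
- move=> H; split; first exact: H.
  by move=> i; rewrite tnth_behead (_ : inord _ = lift ord0 i)//;
    apply/val_inj; rewrite /= inordK // ltnS.
- move=> [H0 H] i; have [->//|i0] := eqVneq i ord0.
  case: (unliftP ord0 i) => [j ->|/eqP]; last by rewrite (negPf i0).
  move: (H j); rewrite tnth_behead (_ : inord _ = lift ord0 j)//.
  by apply/val_inj; rewrite /= inordK // ltnS.
Qed.

Definition softmin_int (R : realType) (d : measure_display)
    (U : measurableType d) (mu : {measure set U -> \bar R}) (h : U -> R) : R :=
  - ln (\int[mu]_u expR (- h u))%R.

Definition softmin_fin (R : realType) (K : finType) (h : K -> R) : R :=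
  - ln (\sum_(k : K) expR (- h k)).

Section Model.
Context (R : realType) (dX dU : measure_display).
Context (X : measurableType dX) (U : measurableType dU).
Variable mu : {sigma_finite_measure set U -> \bar R}.
Variable f : X * U -> X.

Fixpoint trajectory (x : X) (us : seq U) : seq (X * U) :=
  match us with
  | [::] => [::]
  | u :: us' => (x, u) :: trajectory (f (x, u)) us'
  end.

Definition trajectory_cost (c : X * U -> R) (xi : seq (X * U)) : R :=
  \sum_(z <- xi) c z.

(* For t <= T, a trajectory from time t to T has (T - t).+1 inputs. The
   integral is extended-real valued: it may be +oo. *)
Definition trajectory_integral (T : nat) (c : X * U -> R) (t : nat) (x : X)
    : \bar R :=
  (\int[pow_measure mu (T - t).+1]_us
     (expR (- trajectory_cost c (trajectory x us)))%:E)%E.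

Fixpoint soft_value_to_go (c : X * U -> R) (n : nat) (x : X) : R :=
  match n with
  | 0 => 0
  | m.+1 => softmin_int mu
      (fun u => c (x, u) + soft_value_to_go c m (f (x, u)))
  end.

Definition soft_value (T : nat) (c : X * U -> R) (t : nat) (x : X) : R :=
  soft_value_to_go c (T.+1 - t) x.

Definition soft_qvalue (T : nat) (c : X * U -> R) (t : nat) (x : X) (u : U)
    : R :=
  c (x, u) + soft_value T c t.+1 (f (x, u)).

Lemma soft_value_end (T : nat) (c : X * U -> R) (x : X) :
  soft_value T c T.+1 x = 0.
Proof. by rewrite /soft_value subnn. Qed.

Lemma soft_valueE (T : nat) (c : X * U -> R) (t : nat) (x : X) :
  (t <= T)%N -> soft_value T c t x = softmin_int mu (soft_qvalue T c t x).
Proof. by move=> tT; rewrite /soft_value subSn. Qed.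

Variables (K : finType) (C : K -> X * U -> R) (T : nat).

Definition goal_normalizer (t : nat) (x : X) : R :=
  \sum_(k : K) fine (trajectory_integral T (C k) t x).

(* The density of the pair (trajectory, target) with respect to
   du_t ... du_T on the inputs and counting measure on K. *)
Definition goal_density (t : nat) (x : X) (us : seq U) (k : K) : R :=
  expR (- trajectory_cost (C k) (trajectory x us)) / goal_normalizer t x.

(* The marginal density of u_t: the target is summed out and the inputs
   u_(t+1), ..., u_T are integrated out. *)
Definition goal_policy (t : nat) (x : X) (u : U) : R :=
  \sum_(k : K) (\int[pow_measure mu (T - t)]_us
     goal_density t x (u :: us) k)%R.

End Model.

(* Main.v *)
(* Integrating the trajectories one input at a time (Tonelli) shows that the
   total weight exp(-C_k(xi)) of the trajectories with n inputs satisfies the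
   same recursion as exp(-V_k), so the two agree. Integrating the joint density
   over the inputs after u then leaves exp(-Q_k(x, u)) for each target, while
   the normalizer is the sum of the exp(-V_k(x)); both sums over k are
   exponentials of negated soft minima. *)

Require Import Defs.
From HB Require Import structures.
From mathcomp Require Import all_boot all_order all_algebra.
From mathcomp Require Import all_classical all_reals all_analysis.
From mathcomp Require Import measurable_realfun.

Set Implicit Arguments.
Unset Strict Implicit.
Unset Printing Implicit Defensive.

Import Order.TTheory GRing.Theory Num.Theory.
Import numFieldNormedType.Exports.

Local Open Scope classical_set_scope.
Local Open Scope ring_scope.

(** By construction the measure on longer tuples is the image of a product measure under consing, so
    this is a change of variables followed by Tonelli; nonnegativity lets the integrals be
    infinite. *)
Lemma ge0_integral_pow_measureS (R : realType) (d : measure_display)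
    (U : measurableType d) (mu : {sigma_finite_measure set U -> \bar R})
    (n : nat) (h : n.+1.-tuple U -> \bar R) :
  measurable_fun [set: n.+1.-tuple U] h -> (forall w, 0 <= h w)%E ->
  (\int[pow_measure mu n.+1]_w h w =
   \int[mu]_u \int[pow_measure mu n]_v h [tuple of u :: v])%E.
Proof.
move=> mh h0; have mcons := @measurable_cons_pair _ U n.
have h0T : {in setT, forall w, (0 <= h w)%E} by [].
have /= := ge0_integral_pushforward mcons (mu \x pow_measure mu n)%E
  measurableT mh h0T.
by rewrite preimage_setT fubini_tonelli1//; exact: measurableT_comp.
Qed.

Section TrajectoryMass.
Context (R : realType) (dX dU : measure_display).
Context (X : measurableType dX) (U : measurableType dU).
Variables (mu : {sigma_finite_measure set U -> \bar R}) (f : X * U -> X).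
Hypothesis mf : measurable_fun [set: X * U] f.
Variable c : X * U -> R.
Hypothesis mc : measurable_fun [set: X * U] c.

Lemma trajectory_cost_cons (x : X) (u : U) (us : seq U) :
  trajectory_cost c (trajectory f x (u :: us)) =
  c (x, u) + trajectory_cost c (trajectory f (f (x, u)) us).
Proof. by rewrite /trajectory_cost /= big_cons. Qed.

(** Measurability is joint in state and inputs because the induction restarts the tail at
    [f (x, u)], a state that itself depends on the first input. *)
Lemma measurable_trajectory_cost (n : nat) :
  measurable_fun [set: X * n.-tuple U]
    (fun p => trajectory_cost c (trajectory f p.1 p.2)).
Proof.
elim: n => [|n IH].
  rewrite (_ : (fun p => _) = cst (0 : R)); first exact: measurable_cst.
  by apply/funext => -[x us] /=; rewrite tuple0 /trajectory_cost big_nil.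
have mhead : measurable_fun [set: X * n.+1.-tuple U]
    (fun p => (p.1, thead p.2)).
  apply: measurable_fun_pair => //.
  exact: (measurableT_comp (measurable_tnth ord0)).
have mtail : measurable_fun [set: X * n.+1.-tuple U]
    (fun p => (f (p.1, thead p.2), [tuple of behead p.2])).
  apply: measurable_fun_pair; first exact: (measurableT_comp mf).
  exact: (measurableT_comp (@measurable_behead _ U n)).
rewrite (_ : (fun p => _) = (fun p : X * n.+1.-tuple U =>
    c (p.1, thead p.2) + trajectory_cost c
      (trajectory f (f (p.1, thead p.2)) [tuple of behead p.2]))); last first.
  by apply/funext => -[x us] /=; rewrite -trajectory_cost_cons {1}(tuple_eta us).
apply: measurable_funD; first exact: (measurableT_comp mc).
exact: (measurableT_comp IH mtail).
Qed.

(** Indexed by the number of inputs left instead of the starting time, to allow induction;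
    [n = (T - t).+1] gives [trajectory_integral] by conversion. *)
Definition trajectory_mass (n : nat) (x : X) : \bar R :=
  (\int[pow_measure mu n]_us
     (expR (- trajectory_cost c (trajectory f x us)))%:E)%E.

Lemma measurable_trajectory_weight (n : nat) :
  measurable_fun [set: X * n.-tuple U]
    (fun p => (expR (- trajectory_cost c (trajectory f p.1 p.2)))%:E).
Proof.
apply/measurable_EFinP; apply: (measurableT_comp (@measurable_expR R)).
apply: (measurableT_comp (@oppr_measurable R setT)).
exact: measurable_trajectory_cost.
Qed.

Lemma measurable_trajectory_weightr (n : nat) (x : X) :
  measurable_fun [set: n.-tuple U]
    (fun us => (expR (- trajectory_cost c (trajectory f x us)))%:E).
Proof.
exact: measurableT_comp (@measurable_trajectory_weight n) (pair1_measurable x).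
Qed.

Lemma measurable_trajectory_weight_cons (n : nat) (x : X) (u : U) :
  measurable_fun [set: n.-tuple U]
    (fun us => (expR (- trajectory_cost c (trajectory f x (u :: us))))%:E).
Proof.
have mcons : measurable_fun [set: n.-tuple U] (fun us => [tuple of u :: us]).
  exact: measurable_cons.
exact: measurableT_comp (@measurable_trajectory_weightr n.+1 x) mcons.
Qed.

Lemma trajectory_mass_ge0 (n : nat) (x : X) : (0 <= trajectory_mass n x)%E.
Proof. by apply: integral_ge0 => us _; rewrite lee_fin expR_ge0. Qed.

Lemma trajectory_mass0 (x : X) : trajectory_mass 0 x = 1%E.
Proof.
rewrite /trajectory_mass /= integral_dirac//; last first.
  exact: measurable_trajectory_weightr.
by rewrite diracT mul1e /trajectory_cost big_nil oppr0 expR0.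
Qed.

(** The first stage cost is constant in the later inputs and factors out. This gives both the
    recursion for the mass and, later, the marginal of the first input. *)
Lemma integral_trajectory_weight_cons (n : nat) (x : X) (u : U) :
  (\int[pow_measure mu n]_us
     (expR (- trajectory_cost c (trajectory f x (u :: us))))%:E =
   (expR (- c (x, u)))%:E * trajectory_mass n (f (x, u)))%E.
Proof.
under eq_integral => us _ do
  rewrite trajectory_cost_cons opprD expRD EFinM.
rewrite ge0_integralZl_EFin ?expR_ge0//.
exact: measurable_trajectory_weightr.
Qed.

Lemma trajectory_massS (n : nat) (x : X) :
  trajectory_mass n.+1 x =
  (\int[mu]_u ((expR (- c (x, u)))%:E * trajectory_mass n (f (x, u))))%E.
Proof.
rewrite {1}/trajectory_mass ge0_integral_pow_measureS.
- by apply: eq_integral => u _; exact: integral_trajectory_weight_cons.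
- exact: measurable_trajectory_weightr.
- by move=> us; rewrite lee_fin expR_ge0.
Qed.

(** Mass and exponentiated value obey the same recursion. The bounds on the mass start at length 1,
    since the empty trajectory has mass 1 outright. *)
Lemma expRN_soft_value_to_go (N : nat)
    (mass_fin : forall n x, (0 < n <= N)%N ->
       (0 < trajectory_mass n x < +oo)%E) (n : nat) (x : X) :
  (n <= N)%N ->
  (expR (- soft_value_to_go mu f c n x))%:E = trajectory_mass n x.
Proof.
elim: n x => [|n IH] x nN; first by rewrite /= oppr0 expR0 trajectory_mass0.
have /andP[mass_gt0 mass_ltoo] : (0 < trajectory_mass n.+1 x < +oo)%E.
  exact: mass_fin.
have mass_fin_num : trajectory_mass n.+1 x \is a fin_num.
  by rewrite ge0_fin_numE// trajectory_mass_ge0.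
rewrite /= /softmin_int opprK /Rintegral.
have -> : (\int[mu]_u
    (expR (- (c (x, u) + soft_value_to_go mu f c n (f (x, u)))))%:E)%E =
    trajectory_mass n.+1 x.
  rewrite trajectory_massS; apply: eq_integral => u _.
  by rewrite opprD expRD EFinM; congr (_ * _)%E; exact: IH (ltnW nN).
(* Finiteness and positivity of the mass keep [fine] and [ln] away from their default values. *)
by rewrite lnK ?fineK// posrE fine_gt0// mass_gt0.
Qed.

End TrajectoryMass.

(** A nonempty [K] makes both sums positive, so [expR] undoes both logarithms. *)
Lemma expR_softmin_finB (R : realType) (K : finType) (v q : K -> R) :
  (0 < #|K|)%N ->
  expR (softmin_fin v - softmin_fin q) =
  (\sum_(k : K) expR (- q k)) / \sum_(k : K) expR (- v k).
Proof.
move=> /card_gt0P[k0 _].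
have sum_gt0 (h : K -> R) : 0 < \sum_(k : K) expR (- h k).
  rewrite (bigD1 k0)//= ltr_wpDr ?expR_gt0//.
  by apply: sumr_ge0 => k _; exact: expR_ge0.
by rewrite /softmin_fin opprK addrC expRB !lnK// posrE.
Qed.

Theorem theorem2 (R : realType) (dX dU : measure_display)
    (X : measurableType dX) (U : measurableType dU)
    (mu : {sigma_finite_measure set U -> \bar R})
    (f : X * U -> X) (mf : measurable_fun [set: X * U] f)
    (K : finType) (K_nonempty : (0 < #|K|)%N)
    (C : K -> X * U -> R) (mC : forall k, measurable_fun [set: X * U] (C k))
    (T : nat)
    (trajectory_integral_fin : forall (k : K) (t : nat) (x : X), (t <= T)%N ->
       (0 < trajectory_integral mu f T (C k) t x < +oo)%E)
    (t : nat) (t_le_T : (t <= T)%N) (x : X) (u : U) :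
  goal_policy mu f C T t x u =
  expR (softmin_fin (fun k => soft_value mu f T (C k) t x) -
        softmin_fin (fun k => soft_qvalue mu f T (C k) t x u)).
Proof.
have mass_fin k n y : (0 < n <= T.+1)%N ->
    (0 < trajectory_mass mu f (C k) n y < +oo)%E.
  case: n => // n /= nT.
  (* Trajectories with [n.+1] inputs are those that start at time [T - n]. *)
  have := trajectory_integral_fin k (T - n)%N y (leq_subr n T).
  by rewrite /trajectory_integral subKn.
have expRN_value k := expRN_soft_value_to_go mf (mC k) (mass_fin k).
have normE : goal_normalizer mu f C T t x =
    \sum_(k : K) expR (- soft_value mu f T (C k) t x).
  apply: eq_bigr => k _.
  rewrite -[trajectory_integral _ _ _ _ _ _]/(trajectory_mass _ _ _ _ _).
  by rewrite /soft_value subSn// -expRN_value// ltnS leq_subr.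
have norm_ge0 : 0 <= (goal_normalizer mu f C T t x)^-1.
  by rewrite invr_ge0 normE sumr_ge0// => k _; exact: expR_ge0.
(* The normalizer is common to all targets, so the claim is checked target by target. *)
rewrite expR_softmin_finB// -normE mulr_suml; apply: eq_bigr => k _.
rewrite /Rintegral /goal_density.
under eq_integral => us _ do rewrite mulrC EFinM.
rewrite ge0_integralZl_EFin//; last first.
  exact: (measurable_trajectory_weight_cons mf (mC k)).
(* After [u], [T - t] inputs remain, possibly none; their mass is the exponential of minus the value
   at time [t.+1]. *)
have leTt : (T - t <= T.+1)%N by rewrite (leq_trans (leq_subr t T)).
rewrite (integral_trajectory_weight_cons mu mf (mC k)).
rewrite -(expRN_value k _ _ leTt) -!EFinM /= -expRD -opprD mulrC.
by rewrite /soft_qvalue /soft_value subSS.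
Qed.
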